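(* Let $n\ge 2$ be an integer, let $\alpha\in[0,1)$, and let $\mathcal{E}_0,\mathcal{E}_1:[0,1)\to\mathbb{C}$ satisfy: $\mathcal{E}_0,\mathcal{E}_1\in C([0,1))\cap C^n((0,1))$; $x^\alpha\mathcal{E}_{0x},\,y^\alpha\mathcal{E}_{1y}\in C([0,1))$; $\mathcal{E}_0(0)=\mathcal{E}_1(0)=1$; $\operatorname{Re}\mathcal{E}_0(x)>0$ for $x\in[0,1)$; $\operatorname{Re}\mathcal{E}_1(y)>0$ for $y\in[0,1)$. Then the $C^n$-solution $\mathcal{E}(x,y)$ of the Goursat problem for the hyperbolic Ernst equation in $D$ with data $\{\mathcal{E}_0,\mathcal{E}_1\}$ is unique, if it exists. In fact, the value of $\mathcal{E}$ at a point $(x,y)\in D$ is uniquely determined by the boundary values $\mathcal{E}_0(x')$ and $\mathcal{E}_1(y')$ for $0\le x'\le x$ and $0\le y'\le y$; that is, if $\mathcal{E}$ and $\tilde{\mathcal{E}}$ are $C^n$-solutions with data $\{\mathcal{E}_0,\mathcal{E}_1\}$ and $\{\tilde{\mathcal{E}}_0,\tilde{\mathcal{E}}_1\}$, where $\tilde{\mathcal{E}}_0,\tilde{\mathcal{E}}_1:[0,1)\to\mathbb{C}$ likewise satisfy $\tilde{\mathcal{E}}_0,\tilde{\mathcal{E}}_1\in C([0,1))\cap C^n((0,1))$, $x^\alpha\tilde{\mathcal{E}}_{0x},\,y^\alpha\tilde{\mathcal{E}}_{1y}\in C([0,1))$, $\tilde{\mathcal{E}}_0(0)=\tilde{\mathcal{E}}_1(0)=1$,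 $\operatorname{Re}\tilde{\mathcal{E}}_0(x)>0$ for $x\in[0,1)$, and $\operatorname{Re}\tilde{\mathcal{E}}_1(y)>0$ for $y\in[0,1)$, and $\mathcal{E}_0=\tilde{\mathcal{E}}_0$ on $[0,x]$, $\mathcal{E}_1=\tilde{\mathcal{E}}_1$ on $[0,y]$, then $\mathcal{E}(x,y)=\tilde{\mathcal{E}}(x,y)$.
   Context: $D=\{(x,y)\in\mathbb{R}^2: x\ge0,\ y\ge0,\ x+y<1\}$, with interior $\operatorname{int}D$. Subscripts $x,y$ denote (partial) derivatives. Conditions such as ''$x^\alpha f_x\in C(S)$'' mean that the function has a continuous extension to $S$. The hyperbolic Ernst equation is $(\operatorname{Re}\mathcal{E})\Big(\mathcal{E}_{xy}-\frac{\mathcal{E}_x+\mathcal{E}_y}{2(1-x-y)}\Big)=\mathcal{E}_x\mathcal{E}_y$. $C^n$-solution: a function $\mathcal{E}:D\to\mathbb{C}$ is a $C^n$-solution of the Goursat problem for the hyperbolic Ernst equation in $D$ with data $\{\mathcal{E}_0,\mathcal{E}_1\}$ if $\mathcal{E}\in C(D)\cap C^n(\operatorname{int}D)$; $\mathcal{E}$ satisfies the equation in $\operatorname{int}D$; $x^\alpha\mathcal{E}_x,\,y^\alpha\mathcal{E}_y,\,x^\alpha y^\alpha\mathcal{E}_{xy}\in C(D)$ for some $\alpha\in[0,1)$; $\mathcal{E}(x,0)=\mathcal{E}_0(x)$ for $x\in[0,1)$; $\mathcal{E}(0,y)=\mathcal{E}_1(y)$ for $y\in[0,1)$; and $\operatorname{Re}\mathcal{E}(x,y)>0$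 for $(x,y)\in D$. *)

(* Defs.v *)
(* Stdlib reals with Coquelicot.  Functions with domain D, [0,1), ... are total
   functions; every condition below only involves their values on that domain. *)
From Stdlib Require Import Reals Lra.
From Coquelicot Require Import Coquelicot.
Open Scope R_scope.

(* Derivative of a C-valued function of a real variable (Coquelicot's [C_derive]
   is the complex derivative of functions C -> C).  It is total, and equals the
   derivative wherever the latter exists, see [is_derive_RC_derive]. *)
Definition RC_derive (f : R -> C) (x : R) : C :=
  (Derive (fun t => Re (f t)) x, Derive (fun t => Im (f t)) x).

Lemma is_derive_RC_derive (f : R -> C) (x : R) :
  ex_derive (V := C_R_NormedModule) f x ->
  is_derive (V := C_R_NormedModule) f x (RC_derive f x).
Proof.
intros [l Hl].
assert (H1 : is_derive (fun t => Re (f t)) x (Re l)).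
{ apply (filterdiff_ext_lin _
    (fun y : R => fst (@scal R_AbsRing C_R_NormedModule y l) : R)).
  - apply (filterdiff_comp' (U := R_NormedModule) (V := C_R_NormedModule)
             (W := R_NormedModule) f fst x _ fst Hl).
    apply (filterdiff_linear (U := C_R_NormedModule) (V := R_NormedModule)).
    apply (is_linear_fst (U := R_NormedModule) (V := R_NormedModule)).
  - intros y; reflexivity. }
assert (H2 : is_derive (fun t => Im (f t)) x (Im l)).
{ apply (filterdiff_ext_lin _
    (fun y : R => snd (@scal R_AbsRing C_R_NormedModule y l) : R)).
  - apply (filterdiff_comp' (U := R_NormedModule) (V := C_R_NormedModule)
             (W := R_NormedModule) f snd x _ snd Hl).
    apply (filterdiff_linear (U := C_R_NormedModule) (V := R_NormedModule)).
    apply (is_linear_snd (U := R_NormedModule) (V := R_NormedModule)).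
  - intros y; reflexivity. }
replace (RC_derive f x) with (l : C); [exact Hl|].
apply injective_projections; symmetry;
  [exact (is_derive_unique _ _ _ H1) | exact (is_derive_unique _ _ _ H2)].
Qed.

Definition partial_x (f : R * R -> C) (p : R * R) : C :=
  RC_derive (fun t => f (t, snd p)) (fst p).

Definition partial_y (f : R * R -> C) (p : R * R) : C :=
  RC_derive (fun t => f (fst p, t)) (snd p).

(* f is of class C^n on the open set U. *)
Fixpoint Cn1 (n : nat) (U : R -> Prop) (f : R -> C) : Prop :=
  continuous_on U f /\
  match n with
  | O => True
  | S m =>
      (forall x, U x -> ex_derive (V := C_R_NormedModule) f x) /\
      Cn1 m U (RC_derive f)
  end.

Fixpoint Cn2 (n : nat) (U : R * R -> Prop) (f : R * R -> C) : Prop :=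
  continuous_on U f /\
  match n with
  | O => True
  | S m =>
      (forall x y, U (x, y) ->
         ex_derive (V := C_R_NormedModule) (fun t => f (t, y)) x /\
         ex_derive (V := C_R_NormedModule) (fun t => f (x, t)) y) /\
      Cn2 m U (partial_x f) /\ Cn2 m U (partial_y f)
  end.

(* g, considered on U only, has a continuous extension to S. *)
Definition extends_continuously {T : UniformSpace} (U S : T -> Prop)
    (g : T -> C) : Prop :=
  exists G : T -> C, continuous_on S G /\ forall p, U p -> G p = g p.

Definition Ioo01 (x : R) : Prop := 0 < x < 1.
Definition Ico01 (x : R) : Prop := 0 <= x < 1.

Definition domD (p : R * R) : Prop :=
  0 <= fst p /\ 0 <= snd p /\ fst p + snd p < 1.

Definition int_domD (p : R * R) : Prop := locally p domD.

(* In particular [Rpower] below is only evaluated at positive bases. *)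
Lemma interior_domD_iff (x y : R) : int_domD (x, y) <-> 0 < x /\ 0 < y /\ x + y < 1.
Proof.
split.
- intros [e He].
  assert (He0 := cond_pos e).
  assert (HB : forall s t, Rabs s < e -> Rabs t < e -> domD (x + s, y + t)).
  { intros s t Hs Ht; apply He; split; simpl;
      unfold ball; simpl; unfold AbsRing_ball, abs, minus, plus, opp; simpl.
    - now replace (x + s + - x) with s by ring.
    - now replace (y + t + - y) with t by ring. }
  assert (A : Rabs (- (e / 2)) < e)
    by (rewrite Rabs_Ropp, Rabs_pos_eq; lra).
  assert (A0 : Rabs 0 < e) by (rewrite Rabs_R0; lra).
  destruct (HB _ _ A A0) as (h1 & _ & _).
  destruct (HB _ _ A0 A) as (_ & h2 & _).
  destruct (HB _ _ A0 A0) as (_ & _ & h3).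
  simpl in *; lra.
- intros (hx & hy & hxy).
  set (m := Rmin (Rmin x y) ((1 - x - y) / 2)).
  assert (hm1 : m <= x)
    by (eapply Rle_trans; [apply Rmin_l | apply Rmin_l]).
  assert (hm2 : m <= y)
    by (eapply Rle_trans; [apply Rmin_l | apply Rmin_r]).
  assert (hm3 : m <= (1 - x - y) / 2) by apply Rmin_r.
  assert (hm : 0 < m) by (repeat apply Rmin_glb_lt; lra).
  exists (mkposreal m hm); intros [u v] [Hu Hv].
  unfold ball in Hu, Hv; simpl in Hu, Hv.
  unfold AbsRing_ball, abs, minus, plus, opp in Hu, Hv; simpl in Hu, Hv.
  apply Rabs_def2 in Hu; apply Rabs_def2 in Hv.
  unfold domD; simpl; lra.
Qed.

Definition ernst_at (E : R * R -> C) (x y : R) : Prop :=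
  (RtoC (Re (E (x, y))) *
     (partial_y (partial_x E) (x, y)
      - (partial_x E (x, y) + partial_y E (x, y)) / RtoC (2 * (1 - x - y)))
   = partial_x E (x, y) * partial_y E (x, y))%C.

Record admissible_data (n : nat) (alpha : R) (E0 E1 : R -> C) : Prop := {
  data_cont0 : continuous_on Ico01 E0;
  data_cont1 : continuous_on Ico01 E1;
  data_Cn0 : Cn1 n Ioo01 E0;
  data_Cn1 : Cn1 n Ioo01 E1;
  data_deriv0 : extends_continuously Ioo01 Ico01
                  (fun x => (RtoC (Rpower x alpha) * RC_derive E0 x)%C);
  data_deriv1 : extends_continuously Ioo01 Ico01
                  (fun y => (RtoC (Rpower y alpha) * RC_derive E1 y)%C);
  data_at0 : E0 0 = RtoC 1 /\ E1 0 = RtoC 1;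
  data_pos0 : forall x, Ico01 x -> 0 < Re (E0 x);
  data_pos1 : forall y, Ico01 y -> 0 < Re (E1 y)
}.

Record goursat_solution (n : nat) (E0 E1 : R -> C) (E : R * R -> C) : Prop := {
  sol_cont : continuous_on domD E;
  sol_Cn : Cn2 n int_domD E;
  sol_eq : forall x y, int_domD (x, y) -> ernst_at E x y;
  sol_deriv : exists alpha : R, 0 <= alpha < 1 /\
    extends_continuously int_domD domD
      (fun p => (RtoC (Rpower (fst p) alpha) * partial_x E p)%C) /\
    extends_continuously int_domD domD
      (fun p => (RtoC (Rpower (snd p) alpha) * partial_y E p)%C) /\
    extends_continuously int_domD domD
      (fun p => (RtoC (Rpower (fst p) alpha * Rpower (snd p) alpha)
                 * partial_y (partial_x E) p)%C);
  sol_bdry0 : forall x, Ico01 x -> E (x, 0) = E0 x;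
  sol_bdry1 : forall y, Ico01 y -> E (0, y) = E1 y;
  sol_pos : forall p, domD p -> 0 < Re (E p)
}.

(* Main.v *)
(* Write u for the difference of two solutions, a for the larger of their two
   exponents and take a rectangle [0,x0] x [0,y0] in D.  Subtracting the
   equations gives
     |u_xy| <= K (y^-a |u_x| + x^-a |u_y| + x^-a y^-a |u|).
   On the axes u = 0, and the weighted continuous extensions of the derivatives
   force u_x -> 0 as y -> 0 and u_y -> 0 as x -> 0.  The singular weights are
   integrable, so a Gronwall argument with the weight
   exp (lam (x^(1-a) + y^(1-a))), where all integrations are mean value
   inequalities, yields u = 0. *)
Require Import Defs.
From Stdlib Require Import Reals Lra Lia Classical ClassicalEpsilon.
From Coquelicot Require Import Coquelicot.
Open Scope R_scope.

(** The equation holds only in the interior, and the extension of x^a u_x to the axis y = 0 is not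
    assumed to agree there with the derivative of the data, so the limit 0 of u_x has to be proved.
    Estimates are therefore made on the half-open rectangle (0,x0] x (0,y0], with one-sided limits
    in place of boundary values. The logarithmic derivative of the weight in x is lam (1-a) x^(-a),
    a multiple of the singularity itself. Hence x^(-a) times the weight has an explicit primitive,
    smaller by the factor 1 / (lam (1-a)), and serves as derivative of a comparison function without
    any improper integral. The bounds on u, u_x and u_y improve together: u comes from u_x, while
    u_x and u_y come from u_xy integrated in y and in x. For large lam each round halves their
    common constant. K is finite because a closed rectangle with corner in D keeps a distance from x
    + y = 1, and Re E has a positive minimum on it. *)

(** * Mean value inequalities for complex-valued functions *)

Lemma Cmod_le_Re_Im (z : C) : Cmod z <= Rabs (Re z) + Rabs (Im z).
Proof.
replace z with (RtoC (Re z) + (0, Im z))%C at 1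
  by (apply injective_projections; simpl; unfold Re, Im; ring).
apply (Rle_trans _ _ _ (Cmod_triangle _ _)), Rplus_le_compat.
- rewrite Cmod_R; apply Rle_refl.
- replace (0, Im z) with (RtoC (Im z) * Ci)%C
    by (apply injective_projections; simpl; ring).
  rewrite Cmod_mult, Cmod_R, Cmod_Ci; lra.
Qed.

Lemma Rabs_Im_le_Cmod (z : C) : Rabs (Im z) <= Cmod z.
Proof. exact (Rle_trans _ _ _ (Rmax_r _ _) (Rmax_Cmod z)). Qed.

Lemma is_derive_Re (g : R -> C) (t : R) (l : C) :
  is_derive (V := C_R_NormedModule) g t l -> is_derive (fun s => Re (g s)) t (Re l).
Proof.
intros H.
apply (filterdiff_ext_lin _
    (fun y : R => fst (@scal R_AbsRing C_R_NormedModule y l) : R)); [|reflexivity].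
apply (filterdiff_comp' (U := R_NormedModule) (V := C_R_NormedModule)
             (W := R_NormedModule) g fst t _ fst H).
apply (filterdiff_linear (U := C_R_NormedModule) (V := R_NormedModule)).
apply (is_linear_fst (U := R_NormedModule) (V := R_NormedModule)).
Qed.

Lemma is_derive_Im (g : R -> C) (t : R) (l : C) :
  is_derive (V := C_R_NormedModule) g t l -> is_derive (fun s => Im (g s)) t (Im l).
Proof.
intros H.
apply (filterdiff_ext_lin _
    (fun y : R => snd (@scal R_AbsRing C_R_NormedModule y l) : R)); [|reflexivity].
apply (filterdiff_comp' (U := R_NormedModule) (V := C_R_NormedModule)
             (W := R_NormedModule) g snd t _ snd H).
apply (filterdiff_linear (U := C_R_NormedModule) (V := R_NormedModule)).
apply (is_linear_snd (U := R_NormedModule) (V := R_NormedModule)).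
Qed.

(** Both [h + g] and [h - g] have nonnegative derivatives, hence are nondecreasing. The majorant [h]
    takes the place of an integral of [dh]. *)
Lemma mean_value_bound (g h dg dh : R -> R) (a b : R) : a < b ->
  (forall t, a <= t <= b -> is_derive g t (dg t)) ->
  (forall t, a <= t <= b -> is_derive h t (dh t)) ->
  (forall t, a <= t <= b -> Rabs (dg t) <= dh t) ->
  Rabs (g b - g a) <= h b - h a.
Proof.
intros hab hg hh hd.
assert (mono : forall f df : R -> R,
  (forall t, a <= t <= b -> is_derive f t (df t) /\ 0 <= df t) -> f a <= f b).
{ intros f df hf.
  destruct (MVT_gen f a b df) as (c & hc & e);
    rewrite Rmin_left, Rmax_right in * by lra.
  - intros t ht; apply hf; lra.
  - intros t ht; apply continuity_pt_filterlim, (ex_derive_continuous (V := R_NormedModule)).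
    exists (df t); apply hf; lra.
  - assert (0 <= df c) by (apply hf; lra). nra. }
apply Rabs_le; split.
- enough (g a + h a <= g b + h b) by lra.
  apply (mono (fun t => g t + h t) (fun t => dg t + dh t)); intros t ht.
  split; [apply (is_derive_plus (V := R_NormedModule)); auto|].
  specialize (hd t ht). apply Rabs_le_between in hd; lra.
- enough (h a - g a <= h b - g b) by lra.
  apply (mono (fun t => h t - g t) (fun t => dh t - dg t)); intros t ht.
  split; [apply (is_derive_minus (V := R_NormedModule)); auto|].
  specialize (hd t ht). apply Rabs_le_between in hd; lra.
Qed.

(* The factor 2 comes from treating real and imaginary parts separately. *)
Lemma mean_value_bound_C (g dg : R -> C) (h dh : R -> R) (a b : R) : a < b ->
  (forall t, a <= t <= b -> is_derive (V := C_R_NormedModule) g t (dg t)) ->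
  (forall t, a <= t <= b -> is_derive h t (dh t)) ->
  (forall t, a <= t <= b -> Cmod (dg t) <= dh t) ->
  Cmod (g b - g a) <= 2 * (h b - h a).
Proof.
intros hab hg hh hd.
apply (Rle_trans _ _ _ (Cmod_le_Re_Im _)).
assert (Rabs (Re (g b) - Re (g a)) <= h b - h a).
{ apply (mean_value_bound (fun t => Re (g t)) h (fun t => Re (dg t)) dh); auto.
  - intros t ht; apply is_derive_Re; auto.
  - intros t ht; apply (Rle_trans _ _ _ (re_le_Cmod _)); auto. }
assert (Rabs (Im (g b) - Im (g a)) <= h b - h a).
{ apply (mean_value_bound (fun t => Im (g t)) h (fun t => Im (dg t)) dh); auto.
  - intros t ht; apply is_derive_Im; auto.
  - intros t ht; apply (Rle_trans _ _ _ (Rabs_Im_le_Cmod _)); auto. }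
unfold Rminus, Re, Im in *; simpl; lra.
Qed.

(** A right-hand limit that never inspects [g 0]: the value of a partial derivative on an axis is
    not known to be its limit from the interior. *)
Definition vanishes_at_0 (g : R -> C) : Prop :=
  forall eps, 0 < eps ->
    exists d, 0 < d /\ forall t, 0 < t < d -> Cmod (g t) < eps.

(** The mean value inequality on [t0, b], with t0 so small that [g t0] is below the supposed excess
    of [Cmod (g b)] over [2 * h b]; the term [- h t0] is dropped by positivity. The end 0 stays
    excluded because [dh] may blow up there. *)
Lemma bound_from_derivative (g dg : R -> C) (h dh : R -> R) (b : R) : 0 < b ->
  vanishes_at_0 g ->
  (forall t, 0 < t <= b -> is_derive (V := C_R_NormedModule) g t (dg t)) ->
  (forall t, 0 < t <= b -> is_derive h t (dh t)) ->
  (forall t, 0 < t <= b -> Cmod (dg t) <= dh t) ->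
  (forall t, 0 < t <= b -> 0 <= h t) ->
  Cmod (g b) <= 2 * h b.
Proof.
intros hb hv hg hh hd hpos.
apply Rnot_lt_le; intros hlt.
destruct (hv (Cmod (g b) - 2 * h b)) as (d & hd0 & hsmall); [lra|].
set (t0 := Rmin d b / 2).
assert (0 < Rmin d b) by (apply Rmin_glb_lt; lra).
assert (Rmin d b <= d) by apply Rmin_l.
assert (Rmin d b <= b) by apply Rmin_r.
assert (ht0 : 0 < t0 < d /\ t0 < b) by (unfold t0; lra).
assert (H2 := mean_value_bound_C g dg h dh t0 b ltac:(lra)
  ltac:(intros; apply hg; lra) ltac:(intros; apply hh; lra)
  ltac:(intros; apply hd; lra)).
assert (H3 := hsmall t0 ltac:(lra)).
assert (H4 := hpos t0 ltac:(lra)).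
assert (H5 : Cmod (g b) <= Cmod (g b - g t0) + Cmod (g t0)).
{ replace (g b) with ((g b - g t0) + g t0)%C at 1 by ring. apply Cmod_triangle. }
lra.
Qed.

(** * Boundary limit of a tangential derivative *)

Lemma is_derive_minus_linear (u : R -> C) (l c : C) (t : R) :
  is_derive (V := C_R_NormedModule) u t l ->
  is_derive (V := C_R_NormedModule) (fun s => u s - RtoC s * c)%C t (l - c)%C.
Proof.
intros H.
apply (is_derive_minus (V := C_R_NormedModule)); [exact H|].
apply (is_derive_ext (V := C_R_NormedModule) (fun s : R => scal s c)).
- intros s; apply injective_projections; simpl;
    unfold scal; simpl; unfold mult; simpl; ring.
- evar_last.
  + apply (is_derive_scal_l (V := C_R_NormedModule) (fun s : R => s)), is_derive_id.
  + apply (scal_one (V := C_R_NormedModule)).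
Qed.

(* The hypotheses hold on the left of [x] only, so that [x] may be the right
   end of the range on which [u] is known to vanish at [y = 0]. *)
Lemma trace_derivative (u ux : R -> R -> C) (x d0 : R) (c : C) : 0 < d0 ->
  (forall t, x - d0 < t <= x -> vanishes_at_0 (u t)) ->
  (forall t y, x - d0 < t <= x -> 0 < y < d0 ->
     is_derive (V := C_R_NormedModule) (fun s => u s y) t (ux t y)) ->
  (forall eps, 0 < eps -> exists d, 0 < d /\
     forall t y, x - d < t <= x -> 0 < y < d -> Cmod (ux t y - c) < eps) ->
  vanishes_at_0 (ux x).
Proof.
intros hd0 hu hux hc.
(* If [ux] is near [c], then u(., y) grows by about m c over [x - m, x]; yet both end values tend to
   0 with y. The error is 2 m eps/4 from the mean value inequality plus m eps/4 from each end, in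
   total m eps. *)
assert (hc0 : Cmod c = 0).
{ apply Rle_antisym; [|apply Cmod_ge_0].
  apply le_epsilon; intros eps heps; rewrite Rplus_0_l.
  destruct (hc (eps / 4)) as (d & hd & hb); [lra|].
  set (m := Rmin d d0 / 2).
  assert (0 < Rmin d d0) by (apply Rmin_glb_lt; lra).
  assert (Rmin d d0 <= d) by apply Rmin_l.
  assert (Rmin d d0 <= d0) by apply Rmin_r.
  assert (hm : 0 < m /\ m < d /\ m < d0) by (unfold m; lra).
  destruct (hu x ltac:(lra) (m * eps / 4)) as (d1 & hd1 & hs1); [nra|].
  destruct (hu (x - m) ltac:(lra) (m * eps / 4)) as (d2 & hd2 & hs2); [nra|].
  set (y := Rmin m (Rmin d1 d2) / 2).
  assert (0 < Rmin m (Rmin d1 d2)) by (repeat apply Rmin_glb_lt; lra).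
  assert (Rmin m (Rmin d1 d2) <= m) by apply Rmin_l.
  assert (Rmin m (Rmin d1 d2) <= Rmin d1 d2) by apply Rmin_r.
  assert (Rmin d1 d2 <= d1) by apply Rmin_l.
  assert (Rmin d1 d2 <= d2) by apply Rmin_r.
  assert (hy : 0 < y /\ y < m /\ y < d1 /\ y < d2) by (unfold y; lra).
  specialize (hs1 y ltac:(lra)); specialize (hs2 y ltac:(lra)).
  assert (hM := mean_value_bound_C (fun s => u s y - RtoC s * c)%C
    (fun s => ux s y - c)%C (fun s => s * (eps / 4)) (fun _ => eps / 4) (x - m) x
    ltac:(lra)
    ltac:(intros; apply is_derive_minus_linear, hux; lra)
    ltac:(intros; auto_derive; [auto|ring])
    ltac:(intros; apply Rlt_le, hb; lra)).
  simpl in hM.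
  assert (hR : Cmod (RtoC m * c)%C = m * Cmod c).
  { rewrite Cmod_mult, Cmod_R, Rabs_pos_eq; lra. }
  assert (hT : Cmod (RtoC m * c)%C <=
     Cmod (u x y - RtoC x * c - (u (x - m)%R y - RtoC (x - m) * c))%C
     + (Cmod (u x y) + Cmod (u (x - m)%R y))).
  { rewrite <- (Cmod_opp (u x y)).
    rewrite <- (Cmod_opp (u x y - RtoC x * c - (u (x - m)%R y - RtoC (x - m) * c))%C).
    replace (RtoC m * c)%C with
      (- (u x y - RtoC x * c - (u (x - m)%R y - RtoC (x - m) * c))
       + - (- u x y + u (x - m)%R y))%C
      by (rewrite RtoC_minus; ring).
    apply (Rle_trans _ _ _ (Cmod_triangle _ _)), Rplus_le_compat_l.
    rewrite Cmod_opp; apply Cmod_triangle. }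
  rewrite hR in hT.
  apply (Rmult_le_reg_l m); [lra|]. nra. }
apply Cmod_eq_0 in hc0; subst c.
intros eps heps; destruct (hc eps heps) as (d & hd & hb).
exists d; split; [exact hd|]; intros y hy.
replace (ux x y) with (ux x y - 0)%C by ring.
apply hb; lra.
Qed.

(** * Boundedness on closed rectangles *)

(** Compactness yields one step size [d] within which [f] varies by less than 2; every point of the
    rectangle is then reached from the origin by a number of such steps that depends only on the
    rectangle. *)
Lemma continuous_on_rectangle_bounded (D : R * R -> Prop) (f : R * R -> R) (a b : R) :
  0 <= a -> 0 <= b -> continuous_on D f ->
  (forall x y, 0 <= x <= a -> 0 <= y <= b -> D (x, y)) ->
  exists M, 0 < M /\ forall x y, 0 <= x <= a -> 0 <= y <= b -> Rabs (f (x, y)) <= M.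
Proof.
intros ha hb hf hD.
(* The radius [2 * d] leaves room for a point within [d] of (u, v) and for a second one within [d]
   of the first. Outside the rectangle the condition is vacuous and the radius 1 is a default. *)
assert (hloc : forall u v, exists d : posreal, 0 <= u <= a -> 0 <= v <= b ->
  forall s t, 0 <= s <= a -> 0 <= t <= b ->
    Rabs (s - u) < 2 * d -> Rabs (t - v) < 2 * d -> Rabs (f (s, t) - f (u, v)) < 1).
{ intros u v.
  destruct (classic (0 <= u <= a /\ 0 <= v <= b)) as [[hu hv]|h];
    [|exists (mkposreal 1 Rlt_0_1); tauto].
  specialize (hf (u, v) (hD u v hu hv)).
  apply (proj1 (filterlim_locally _ _)) with (eps := mkposreal 1 Rlt_0_1) in hf.
  destruct hf as [d hd].
  assert (hd2 : 0 < d / 2) by (apply is_pos_div_2).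
  exists (mkposreal _ hd2); intros _ _ s t hs ht h1 h2; simpl in h1, h2.
  apply (hd (s, t)); [|auto].
  split; [change (Rabs (s - u) < d)|change (Rabs (t - v) < d)]; lra. }
destruct (compactness_value_2d 0 a 0 b
  (fun u v => proj1_sig (constructive_indefinite_description _ (hloc u v))))
  as [d hd].
assert (hunif : forall x y s t, 0 <= x <= a -> 0 <= y <= b -> 0 <= s <= a -> 0 <= t <= b ->
  Rabs (s - x) < d -> Rabs (t - y) < d -> Rabs (f (s, t)) <= Rabs (f (x, y)) + 2).
{ intros x y s t hx hy hs ht h1 h2.
  destruct (NNPP _ (hd x y hx hy)) as (u & v & hu & hv & h3 & h4 & h5).
  destruct (constructive_indefinite_description _ (hloc u v)) as [e he]; simpl in *.
  assert (he0 := cond_pos e).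
  assert (A1 := he hu hv x y hx hy ltac:(lra) ltac:(lra)).
  assert (A2 : Rabs (f (s, t) - f (u, v)) < 1).
  { apply he; auto.
    - replace (s - u) with ((s - x) + (x - u)) by ring.
      generalize (Rabs_triang (s - x) (x - u)); lra.
    - replace (t - v) with ((t - y) + (y - v)) by ring.
      generalize (Rabs_triang (t - y) (y - v)); lra. }
  replace (f (s, t)) with (f (x, y) + ((f (s, t) - f (u, v)) - (f (x, y) - f (u, v)))) by ring.
  generalize (Rabs_triang (f (x, y)) ((f (s, t) - f (u, v)) - (f (x, y) - f (u, v)))).
  apply Rabs_def2 in A1; apply Rabs_def2 in A2.
  assert (Rabs ((f (s, t) - f (u, v)) - (f (x, y) - f (u, v))) < 2) by (apply Rabs_def1; lra).
  lra. }
(* walk from the origin to (x, y) along N equal steps shorter than d *)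
destruct (INR_unbounded ((a + b) / d)) as [N hN].
assert (hd0 := cond_pos d).
assert (hN0 : 0 < INR N).
{ apply Rle_lt_trans with (2 := hN). apply Rdiv_le_0_compat; lra. }
assert (hNd : a + b < INR N * d).
{ apply (Rmult_lt_compat_r d) in hN; [|exact hd0].
  unfold Rdiv in hN; rewrite Rmult_assoc, Rinv_l in hN; lra. }
exists (Rabs (f (0, 0)) + 2 * INR N + 1); split;
  [generalize (Rabs_pos (f (0, 0))); lra|].
intros x y hx hy.
assert (hx' : 0 <= x / INR N < d).
{ split; [apply Rdiv_le_0_compat; lra|].
  apply (Rmult_lt_reg_r (INR N)); [lra|]. unfold Rdiv; rewrite Rmult_assoc, Rinv_l; lra. }
assert (hy' : 0 <= y / INR N < d).
{ split; [apply Rdiv_le_0_compat; lra|].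
  apply (Rmult_lt_reg_r (INR N)); [lra|]. unfold Rdiv; rewrite Rmult_assoc, Rinv_l; lra. }
assert (ex : INR N * (x / INR N) = x) by (field; lra).
assert (ey : INR N * (y / INR N) = y) by (field; lra).
assert (walk : forall k : nat, (k <= N)%nat ->
  Rabs (f (INR k * (x / INR N), INR k * (y / INR N))) <= Rabs (f (0, 0)) + 2 * INR k).
{ induction k as [|k IH]; intros hk.
  - simpl; rewrite !Rmult_0_l; lra.
  - assert (hk1 : INR k + 1 <= INR N) by (rewrite <- S_INR; apply le_INR; lia).
    assert (0 <= INR k) by apply pos_INR.
    specialize (IH ltac:(lia)).
    rewrite S_INR.
    refine (Rle_trans _ _ _ (hunif (INR k * (x / INR N)) (INR k * (y / INR N)) _ _ _ _ _ _ _ _) _).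
    1, 2, 3, 4: split; nra.
    1: replace ((INR k + 1) * (x / INR N) - INR k * (x / INR N)) with (x / INR N) by ring;
       rewrite Rabs_pos_eq; lra.
    1: replace ((INR k + 1) * (y / INR N) - INR k * (y / INR N)) with (y / INR N) by ring;
       rewrite Rabs_pos_eq; lra.
    lra. }
specialize (walk N (le_n N)). rewrite ex, ey in walk. lra.
Qed.

(** * Gronwall argument for the singular linear inequality *)

(** The bound on [dg] is the exact derivative in t of A / (lam gam) exp (lam (s + t^gam)). The
    parameter [s] stands for the power of the other, frozen variable. *)
Lemma weighted_primitive_bound (g dg : R -> C) (A lam gam s b : R) :
  0 < b -> 0 < gam -> 0 < lam -> 0 <= A -> vanishes_at_0 g ->
  (forall t, 0 < t <= b -> is_derive (V := C_R_NormedModule) g t (dg t)) ->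
  (forall t, 0 < t <= b ->
     Cmod (dg t) <= A * Rpower t (gam - 1) * exp (lam * (s + Rpower t gam))) ->
  Cmod (g b) <= 2 * (A / (lam * gam)) * exp (lam * (s + Rpower b gam)).
Proof.
intros hb hgam hlam hA hv hg hdg.
assert (hlg : 0 < lam * gam) by (apply Rmult_lt_0_compat; lra).
rewrite Rmult_assoc.
apply (bound_from_derivative g dg
  (fun t => A / (lam * gam) * exp (lam * (s + Rpower t gam)))
  (fun t => A * Rpower t (gam - 1) * exp (lam * (s + Rpower t gam))) b); auto.
- intros t ht.
  assert (hp : Rpower t (gam - 1) = exp (gam * ln t) * / t).
  { unfold Rminus; rewrite Rpower_plus, Rpower_Ropp, Rpower_1 by lra; reflexivity. }
  rewrite hp; unfold Rpower; auto_derive; [lra|field; lra].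
- intros t ht. apply Rmult_le_pos; [apply Rdiv_le_0_compat; lra|].
  apply Rlt_le, exp_pos.
Qed.

(* With the weight [w = exp (lam (x^gam + y^gam))], [lam] large, integrating the
   inequality for [uxy] turns the bounds [C w], [C x^(gam-1) w], [C y^(gam-1) w]
   for [u], [ux], [uy] into the same bounds with [C / 2]. *)
Lemma singular_goursat_zero (u ux uy uxy : R -> R -> C) (a b gam K M : R) :
  0 < a -> 0 < b -> 0 < gam -> 0 <= K -> 0 <= M ->
  (forall y, 0 < y <= b -> vanishes_at_0 (fun x => u x y)) ->
  (forall x, 0 < x <= a -> vanishes_at_0 (fun y => ux x y)) ->
  (forall y, 0 < y <= b -> vanishes_at_0 (fun x => uy x y)) ->
  (forall x y, 0 < x <= a -> 0 < y <= b ->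
     is_derive (V := C_R_NormedModule) (fun s => u s y) x (ux x y) /\
     is_derive (V := C_R_NormedModule) (fun t => ux x t) y (uxy x y) /\
     is_derive (V := C_R_NormedModule) (fun s => uy s y) x (uxy x y)) ->
  (forall x y, 0 < x <= a -> 0 < y <= b ->
     Cmod (u x y) <= M /\
     Cmod (ux x y) <= M * Rpower x (gam - 1) /\
     Cmod (uy x y) <= M * Rpower y (gam - 1)) ->
  (forall x y, 0 < x <= a -> 0 < y <= b ->
     Cmod (uxy x y) <=
       K * (Rpower y (gam - 1) * Cmod (ux x y) + Rpower x (gam - 1) * Cmod (uy x y)
            + Rpower x (gam - 1) * Rpower y (gam - 1) * Cmod (u x y))) ->
  forall x y, 0 < x <= a -> 0 < y <= b -> u x y = RtoC 0.
Proof.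
intros ha hb hgam hK hM hv hvx hvy hd hM0 hpde.
(* Integrating [uxy] produces 2 * 3K / (lam gam): the 3 counts the terms of the inequality, the 2 is
   the loss from real and imaginary parts. This is at most 1/2 once lam gam >= 12K, and the step
   from [ux] to [u] needs lam gam >= 4. The sum meets both and is positive even for K = 0. *)
set (lam := (12 * K + 4) / gam).
assert (hlam : 0 < lam) by (apply Rdiv_lt_0_compat; lra).
assert (hlg : lam * gam = 12 * K + 4) by (unfold lam; field; lra).
set (w := fun x y => exp (lam * (Rpower x gam + Rpower y gam))).
assert (hw : forall x y, 1 <= w x y).
{ intros x y; unfold w.
  assert (0 <= lam * (Rpower x gam + Rpower y gam)).
  { apply Rmult_le_pos; [lra|]; apply Rplus_le_le_0_compat; apply Rlt_le, exp_pos. }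
  generalize (exp_ineq1_le (lam * (Rpower x gam + Rpower y gam))); lra. }
assert (key : forall k : nat, forall x y, 0 < x <= a -> 0 < y <= b ->
     Cmod (u x y) <= M / 2 ^ k * w x y /\
     Cmod (ux x y) <= M / 2 ^ k * Rpower x (gam - 1) * w x y /\
     Cmod (uy x y) <= M / 2 ^ k * Rpower y (gam - 1) * w x y).
{ induction k as [|k IH].
  - intros x y hx hy; destruct (hM0 x y hx hy) as (h1 & h2 & h3).
    specialize (hw x y).
    assert (0 < Rpower x (gam - 1)) by apply exp_pos.
    assert (0 < Rpower y (gam - 1)) by apply exp_pos.
    assert (0 <= M * Rpower x (gam - 1)) by nra.
    assert (0 <= M * Rpower y (gam - 1)) by nra.
    replace (M / 2 ^ 0) with M by (simpl; field).
    repeat split; nra.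
  - set (c := M / 2 ^ k) in *.
    assert (hc : 0 <= c) by (apply Rdiv_le_0_compat; [lra|apply pow_lt; lra]).
    assert (hc2 : M / 2 ^ S k = c / 2)
      by (unfold c; simpl; field; apply pow_nonzero; lra).
    rewrite hc2; clear hc2.
    assert (hxy : forall x y, 0 < x <= a -> 0 < y <= b ->
      Cmod (uxy x y) <= 3 * K * c * Rpower x (gam - 1) * Rpower y (gam - 1) * w x y).
    { intros x y hx hy. apply (Rle_trans _ _ _ (hpde x y hx hy)).
      destruct (IH x y hx hy) as (h1 & h2 & h3).
      assert (hX : 0 < Rpower x (gam - 1)) by apply exp_pos.
      assert (hY : 0 < Rpower y (gam - 1)) by apply exp_pos.
      set (X := Rpower x (gam - 1)) in *; set (Y := Rpower y (gam - 1)) in *.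
      set (W := w x y) in *.
      replace (3 * K * c * X * Y * W) with
        (K * (Y * (c * X * W) + X * (c * Y * W) + X * Y * (c * W))) by ring.
      apply Rmult_le_compat_l; [lra|].
      repeat apply Rplus_le_compat; apply Rmult_le_compat_l; nra. }
    assert (hKc : 0 <= 3 * K * c) by (clearbody c; nra).
    (* Used with A = 4 for [u] and A = 12K for [ux], [uy]; dividing by 2 and by 4 respectively gives
       the new constant c / 2 or less. *)
    assert (half : forall A N : R, 0 <= N -> 0 <= A <= 12 * K + 4 ->
      c * N * (A / (lam * gam)) <= c * N * 1).
    { intros A N hN hA. apply Rmult_le_compat_l; [nra|].
      rewrite hlg. apply (Rmult_le_reg_r (12 * K + 4)); [lra|].
      unfold Rdiv; rewrite Rmult_assoc, Rinv_l; lra. }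
    intros x y hx hy.
    assert (hX : 0 < Rpower x (gam - 1)) by apply exp_pos.
    assert (hY : 0 < Rpower y (gam - 1)) by apply exp_pos.
    assert (hW : 0 < w x y) by (specialize (hw x y); lra).
    split; [|split].
    + assert (H := weighted_primitive_bound (fun s => u s y) (fun s => ux s y)
        c lam gam (Rpower y gam) x (proj1 hx) hgam hlam hc (hv y hy)
        ltac:(intros t ht; apply hd; lra)
        ltac:(intros t ht; rewrite (Rplus_comm (Rpower y gam)); apply IH; lra)).
      rewrite (Rplus_comm (Rpower y gam)) in H; fold (w x y) in H.
      apply (Rle_trans _ _ _ H).
      apply Rmult_le_compat_r; [lra|].
      specialize (half 4 1 ltac:(lra) ltac:(lra)). unfold Rdiv in *; lra.
    + assert (H := weighted_primitive_bound (fun t => ux x t) (fun t => uxy x t)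
        (3 * K * c * Rpower x (gam - 1)) lam gam (Rpower x gam) y (proj1 hy) hgam hlam
        ltac:(nra) (hvx x hx)
        ltac:(intros t ht; apply hd; lra)
        ltac:(intros t ht; apply hxy; lra)).
      fold (w x y) in H. apply (Rle_trans _ _ _ H).
      apply Rmult_le_compat_r; [lra|].
      specialize (half (12 * K) (Rpower x (gam - 1)) ltac:(lra) ltac:(lra)).
      unfold Rdiv in *; lra.
    + assert (H := weighted_primitive_bound (fun s => uy s y) (fun s => uxy s y)
        (3 * K * c * Rpower y (gam - 1)) lam gam (Rpower y gam) x (proj1 hx) hgam hlam
        ltac:(nra) (hvy y hy)
        ltac:(intros t ht; apply hd; lra)
        ltac:(intros t ht; rewrite (Rplus_comm (Rpower y gam));
              fold (w t y); specialize (hxy t y ltac:(lra) ltac:(lra)); lra)).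
      rewrite (Rplus_comm (Rpower y gam)) in H; fold (w x y) in H.
      apply (Rle_trans _ _ _ H).
      apply Rmult_le_compat_r; [lra|].
      specialize (half (12 * K) (Rpower y (gam - 1)) ltac:(lra) ltac:(lra)).
      unfold Rdiv in *; lra. }
intros x y hx hy.
apply Cmod_eq_0, Rle_antisym; [|apply Cmod_ge_0].
apply le_epsilon; intros eps heps; rewrite Rplus_0_l.
assert (hmw : 0 <= M * w x y) by (specialize (hw x y); nra).
(* The bound M w / 2^N falls below eps; the added 1 keeps the denominator positive when M = 0. *)
destruct (pow_lt_1_zero (/ 2) ltac:(rewrite Rabs_pos_eq; lra)
  (eps / (M * w x y + 1)) ltac:(apply Rdiv_lt_0_compat; lra)) as [N hN].
specialize (hN N (le_n N)).
destruct (key N x y hx hy) as [h _].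
apply (Rle_trans _ _ _ h).
rewrite Rabs_pos_eq in hN by (apply pow_le; lra).
unfold Rdiv; rewrite <- pow_inv.
apply (Rmult_lt_compat_r (M * w x y + 1)) in hN; [|lra].
unfold Rdiv in hN; rewrite (Rmult_assoc eps), Rinv_l in hN by lra.
assert (0 <= (/ 2) ^ N) by (apply pow_le; lra).
nra.
Qed.

(** * Consequences of the weighted continuous extensions *)

Lemma filterlim_within_eps (U : R * R -> Prop) (f : R * R -> C) (x y : R) (c : C) :
  filterlim f (within U (locally (x, y))) (locally c) ->
  forall eps, 0 < eps -> exists d, 0 < d /\ forall s t, U (s, t) ->
    Rabs (s - x) < d -> Rabs (t - y) < d -> Cmod (f (s, t) - c) < eps.
Proof.
intros hf eps heps.
assert (heps2 : 0 < eps / 2) by lra.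
apply (proj1 (filterlim_locally _ _)) with (eps := mkposreal _ heps2) in hf.
destruct hf as [d hd].
exists d; split; [apply cond_pos|]; intros s t hU hs ht.
destruct (hd (s, t) (conj hs ht) hU) as [h1 h2].
change (Rabs (Re (f (s, t)) - Re c) < eps / 2) in h1.
change (Rabs (Im (f (s, t)) - Im c) < eps / 2) in h2.
apply (Rle_lt_trans _ _ _ (Cmod_le_Re_Im _)).
unfold Rminus, Re, Im in *; simpl; lra.
Qed.

Lemma int_domD_domD (p : R * R) : int_domD p -> domD p.
Proof. apply locally_singleton. Qed.

Lemma continuous_on_vanishes_x (f : R * R -> C) (y : R) :
  continuous_on domD f -> 0 <= y < 1 -> f (0, y) = RtoC 0 ->
  vanishes_at_0 (fun x => f (x, y)).
Proof.
intros hf hy h0 eps heps.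
assert (hD : domD (0, y)) by (unfold domD; simpl; lra).
destruct (filterlim_within_eps _ _ _ _ _ (hf _ hD) eps heps) as (d & hd & H).
exists (Rmin d (1 - y)); split; [apply Rmin_glb_lt; lra|]; intros t ht.
assert (Rmin d (1 - y) <= d) by apply Rmin_l.
assert (Rmin d (1 - y) <= 1 - y) by apply Rmin_r.
replace (f (t, y)) with (f (t, y) - f (0, y))%C by (rewrite h0; ring).
apply H.
- unfold domD; simpl; lra.
- rewrite Rabs_pos_eq; lra.
- rewrite Rabs_pos_eq; lra.
Qed.

Lemma continuous_on_vanishes_y (f : R * R -> C) (x : R) :
  continuous_on domD f -> 0 <= x < 1 -> f (x, 0) = RtoC 0 ->
  vanishes_at_0 (fun y => f (x, y)).
Proof.
intros hf hx h0 eps heps.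
assert (hD : domD (x, 0)) by (unfold domD; simpl; lra).
destruct (filterlim_within_eps _ _ _ _ _ (hf _ hD) eps heps) as (d & hd & H).
exists (Rmin d (1 - x)); split; [apply Rmin_glb_lt; lra|]; intros t ht.
assert (Rmin d (1 - x) <= d) by apply Rmin_l.
assert (Rmin d (1 - x) <= 1 - x) by apply Rmin_r.
replace (f (x, t)) with (f (x, t) - f (x, 0))%C by (rewrite h0; ring).
apply H.
- unfold domD; simpl; lra.
- rewrite Rabs_pos_eq; lra.
- rewrite Rabs_pos_eq; lra.
Qed.

(** The extension is divided by the weight. At (x, 0) with x > 0 the weight x^alpha is positive, so
    the unweighted x-derivative has a limit there; likewise the y-derivative at (0, y). *)
Lemma weighted_extension_limit (U S : R * R -> Prop) (k : R * R -> R)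
    (f : R * R -> C) (p : R * R) :
  (forall q, U q -> S q) -> (forall q, U q -> k q <> 0) ->
  extends_continuously U S (fun q => (RtoC (k q) * f q)%C) ->
  S p -> k p <> 0 -> continuous k p ->
  exists c : C, filterlim f (within U (locally p)) (locally c).
Proof.
intros hUS hkU (G & hG & hGf) hp hkp hk.
exists (@scal R_AbsRing C_R_NormedModule (/ k p) (G p)).
apply filterlim_within_ext with
  (f := fun q => @scal R_AbsRing C_R_NormedModule (/ k q) (G q)).
{ intros q hq; rewrite (hGf q hq); specialize (hkU q hq).
  apply injective_projections; simpl;
    unfold scal; simpl; unfold mult; simpl; field; assumption. }
apply (filterlim_comp_2 (F := within U (locally p)) (G := locally (/ k p))
  (H := locally (G p)) (fun q => / k q) G
  (@scal R_AbsRing C_R_NormedModule)).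
- apply (filterlim_filter_le_1 (F := locally p)).
  + intros P [d hd]; exists d; intros q hq _; auto.
  + apply (continuous_comp k Rinv p hk), continuous_Rinv, hkp.
- apply (filterlim_filter_le_1 (F := within S (locally p))).
  + intros P [d hd]; exists d; intros q hq hU; auto.
  + exact (hG p hp).
- apply (filterlim_scal (V := C_R_NormedModule)).
Qed.

Lemma weighted_extension_bounded (U S : R * R -> Prop) (k : R * R -> R)
    (f : R * R -> C) (a b : R) :
  0 <= a -> 0 <= b ->
  (forall x y, 0 <= x <= a -> 0 <= y <= b -> S (x, y)) ->
  extends_continuously U S (fun q => (RtoC (k q) * f q)%C) ->
  exists M, 0 < M /\ forall x y, 0 <= x <= a -> 0 <= y <= b -> U (x, y) ->
    Rabs (k (x, y)) * Cmod (f (x, y)) <= M.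
Proof.
intros ha hb hS (G & hG & hGf).
destruct (continuous_on_rectangle_bounded S (fun q => Re (G q)) a b ha hb)
  as (M1 & hM1 & B1); [|exact hS|].
{ intros q hq; apply (filterlim_comp _ _ _ G Re _ _ _ (hG q hq)).
  apply continuous_fst. }
destruct (continuous_on_rectangle_bounded S (fun q => Im (G q)) a b ha hb)
  as (M2 & hM2 & B2); [|exact hS|].
{ intros q hq; apply (filterlim_comp _ _ _ G Im _ _ _ (hG q hq)).
  apply continuous_snd. }
exists (M1 + M2); split; [lra|]; intros x y hx hy hU.
rewrite <- Cmod_R, <- Cmod_mult, <- (hGf _ hU).
apply (Rle_trans _ _ _ (Cmod_le_Re_Im _)), Rplus_le_compat; auto.
Qed.

Lemma continuous_Rpower (alpha x : R) : 0 < x -> continuous (fun t => Rpower t alpha) x.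
Proof.
intros hx; apply (ex_derive_continuous (V := R_NormedModule)).
exists (alpha * Rpower x (alpha - 1)).
apply is_derive_Reals, derivable_pt_lim_power, hx.
Qed.

(** Lets the bounds of two solutions with different exponents be stated with the larger one. *)
Lemma Rpower_opp_le (x alpha beta : R) :
  0 < x <= 1 -> alpha <= beta -> Rpower x (- alpha) <= Rpower x (- beta).
Proof.
intros hx hab; rewrite !Rpower_Ropp.
unfold Rpower; rewrite <- !exp_Ropp.
assert (hl : ln x <= 0).
{ rewrite <- ln_1; destruct (Req_dec x 1) as [->|hne]; [lra|].
  apply Rlt_le, ln_increasing; lra. }
destruct (Req_dec (alpha * ln x) (beta * ln x)) as [->|hne]; [lra|].
apply Rlt_le, exp_increasing. nra.
Qed.

(** * Interior derivatives and symmetry of the mixed ones *)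

Lemma Cn2_is_derive (n : nat) (U : R * R -> Prop) (f : R * R -> C) (x y : R) :
  (1 <= n)%nat -> Cn2 n U f -> U (x, y) ->
  is_derive (V := C_R_NormedModule) (fun s => f (s, y)) x (partial_x f (x, y)) /\
  is_derive (V := C_R_NormedModule) (fun t => f (x, t)) y (partial_y f (x, y)).
Proof.
destruct n as [|n]; [lia|]; intros _ (_ & hd & _) hU.
destruct (hd x y hU) as [h1 h2].
split; [exact (is_derive_RC_derive _ _ h1)|exact (is_derive_RC_derive _ _ h2)].
Qed.

Lemma continuous_on_open_continuity_2d (D : R * R -> Prop) (f : R * R -> C) (x y : R) :
  locally (x, y) D -> continuous_on D f ->
  continuity_2d_pt (fun s t => Re (f (s, t))) x y /\
  continuity_2d_pt (fun s t => Im (f (s, t))) x y.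
Proof.
intros hD hf.
assert (H : forall eps : posreal,
  locally_2d (fun s t => Cmod (f (s, t) - f (x, y)) < eps) x y).
{ intros eps.
  destruct (filterlim_within_eps _ _ _ _ _ (hf _ (locally_singleton _ _ hD)) eps (cond_pos eps))
    as (d & hd & Hd).
  destruct hD as [e He].
  assert (hm : 0 < Rmin d e) by (apply Rmin_glb_lt; [lra|apply cond_pos]).
  exists (mkposreal _ hm); simpl; intros s t hs ht.
  assert (Rmin d e <= d) by apply Rmin_l.
  assert (Rmin d e <= e) by apply Rmin_r.
  apply Hd; [|lra|lra].
  apply He; split; [change (Rabs (s - x) < e)|change (Rabs (t - y) < e)]; lra. }
split; intros eps; destruct (H eps) as [d Hd]; exists d; intros s t hs ht;
  apply Rle_lt_trans with (2 := Hd s t hs ht).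
- exact (re_le_Cmod (f (s, t) - f (x, y))%C).
- exact (Rabs_Im_le_Cmod (f (s, t) - f (x, y))%C).
Qed.

(** The theorem of Schwarz for real and imaginary parts; class C^2 supplies both continuous mixed
    derivatives. The Ernst equation controls one order of differentiation, while integrating u_xy to
    bound u_y involves the other. *)
Lemma partial_xy_comm (n : nat) (D : R * R -> Prop) (f : R * R -> C) (x y : R) :
  (2 <= n)%nat -> Cn2 n (fun p => locally p D) f -> locally (x, y) D ->
  partial_x (partial_y f) (x, y) = partial_y (partial_x f) (x, y).
Proof.
intros hn hf hD.
destruct n as [|[|n]]; [lia|lia|].
destruct hf as (_ & d & (_ & dx & _ & hxy) & (_ & dy & hyx & _)).
assert (hloc := locally_locally _ _ hD).
assert (cxy : continuous_on (fun p => locally p D) (partial_y (partial_x f)))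
  by (destruct n; apply hxy).
assert (cyx : continuous_on (fun p => locally p D) (partial_x (partial_y f)))
  by (destruct n; apply hyx).
destruct (continuous_on_open_continuity_2d _ _ x y hloc cxy) as [cxy1 cxy2].
destruct (continuous_on_open_continuity_2d _ _ x y hloc cyx) as [cyx1 cyx2].
assert (exRe : forall (g : R -> C) t,
  ex_derive (V := C_R_NormedModule) g t -> ex_derive (fun s => Re (g s)) t).
{ intros g t [l hl]; exists (Re l); apply is_derive_Re, hl. }
assert (exIm : forall (g : R -> C) t,
  ex_derive (V := C_R_NormedModule) g t -> ex_derive (fun s => Im (g s)) t).
{ intros g t [l hl]; exists (Im l); apply is_derive_Im, hl. }
apply injective_projections.
- change (Derive (fun z => Derive (fun t => Re (f (z, t))) y) x
          = Derive (fun z => Derive (fun t => Re (f (t, z))) x) y).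
  apply (Schwarz (fun s t => Re (f (s, t))) x y); [|exact cyx1|exact cxy1].
  apply locally_2d_locally.
  apply filter_imp with (2 := hloc); intros [s t] hst; simpl.
  destruct (d s t hst), (dx s t hst), (dy s t hst).
  repeat split.
  + apply (exRe (fun z => f (z, t))); assumption.
  + apply (exRe (fun z => f (s, z))); assumption.
  + apply (exRe (fun z => partial_y f (z, t))); assumption.
  + apply (exRe (fun z => partial_x f (s, z))); assumption.
- change (Derive (fun z => Derive (fun t => Im (f (z, t))) y) x
          = Derive (fun z => Derive (fun t => Im (f (t, z))) x) y).
  apply (Schwarz (fun s t => Im (f (s, t))) x y); [|exact cyx2|exact cxy2].
  apply locally_2d_locally.
  apply filter_imp with (2 := hloc); intros [s t] hst; simpl.
  destruct (d s t hst), (dx s t hst), (dy s t hst).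
  repeat split.
  + apply (exIm (fun z => f (z, t))); assumption.
  + apply (exIm (fun z => f (s, z))); assumption.
  + apply (exIm (fun z => partial_y f (z, t))); assumption.
  + apply (exIm (fun z => partial_x f (s, z))); assumption.
Qed.

(** The products are telescoped as p q - p' q' = (p - p') q + p' (q - q'), and 1/r - 1/r' = -(r -
    r') / (r r'). Each term is thus linear in a single difference. Here p, q are the first
    derivatives, r the real part and k = 1 / (2 (1 - x - y)). *)
Lemma ernst_rhs_difference (p q p' q' : C) (k r r' : R) : 0 <= k -> 0 < r -> 0 < r' ->
  Cmod ((p + q) * RtoC k + p * q / RtoC r
        - ((p' + q') * RtoC k + p' * q' / RtoC r'))%C <=
  k * (Cmod (p - p') + Cmod (q - q'))
  + / r * (Cmod (p - p') * Cmod q + Cmod p' * Cmod (q - q'))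
  + / r * / r' * (Cmod p' * Cmod q' * Rabs (r - r')).
Proof.
intros hk hr hr'.
assert (hr0 : RtoC r <> 0) by (intros h; apply RtoC_inj in h; lra).
assert (hr0' : RtoC r' <> 0) by (intros h; apply RtoC_inj in h; lra).
assert (hir := Rinv_0_lt_compat _ hr). assert (hir' := Rinv_0_lt_compat _ hr').
replace ((p + q) * RtoC k + p * q / RtoC r
        - ((p' + q') * RtoC k + p' * q' / RtoC r'))%C with
  (RtoC k * ((p - p') + (q - q'))
   + RtoC (/ r) * ((p - p') * q + p' * (q - q'))
   + RtoC (/ r) * RtoC (/ r') * - (p' * q' * RtoC (r - r')))%C
  by (rewrite !RtoC_inv, RtoC_minus by lra; field; auto).
repeat (apply (Rle_trans _ _ _ (Cmod_triangle _ _)), Rplus_le_compat).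
- rewrite Cmod_mult, Cmod_R, Rabs_pos_eq by lra.
  apply Rmult_le_compat_l, Cmod_triangle; lra.
- rewrite Cmod_mult, Cmod_R, Rabs_pos_eq by lra.
  apply Rmult_le_compat_l; [lra|].
  rewrite <- !Cmod_mult; apply Cmod_triangle.
- rewrite !Cmod_mult, Cmod_opp, !Cmod_mult, !Cmod_R.
  rewrite (Rabs_pos_eq (/ r)), (Rabs_pos_eq (/ r')) by lra.
  apply Rle_refl.
Qed.

Lemma filterlim_Cminus {T : Type} {F : (T -> Prop) -> Prop} {FF : Filter F}
    (f g : T -> C) (a b : C) :
  filterlim f F (locally a) -> filterlim g F (locally b) ->
  filterlim (fun q => f q - g q)%C F (locally (a - b)%C).
Proof.
intros hf hg.
apply (filterlim_comp_2 (G := locally a) (H := locally (- b)%C)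
  f (fun q => - g q)%C Cplus); [exact hf| |].
- apply (filterlim_comp _ _ _ g Copp _ _ _ hg).
  apply (filterlim_opp (V := C_R_NormedModule)).
- apply (filterlim_plus (V := C_R_NormedModule)).
Qed.

Lemma continuous_on_Cminus (D : R * R -> Prop) (f g : R * R -> C) :
  continuous_on D f -> continuous_on D g ->
  continuous_on D (fun q => f q - g q)%C.
Proof. intros hf hg p hp; apply filterlim_Cminus; auto. Qed.

(** * Regularity and bounds of one solution *)

Lemma solution_is_derive (n : nat) (E0 E1 : R -> C) (E : R * R -> C) (x y : R) :
  (2 <= n)%nat -> goursat_solution n E0 E1 E -> int_domD (x, y) ->
  is_derive (V := C_R_NormedModule) (fun s => E (s, y)) x (partial_x E (x, y)) /\
  is_derive (V := C_R_NormedModule) (fun t => E (x, t)) y (partial_y E (x, y)) /\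
  is_derive (V := C_R_NormedModule) (fun t => partial_x E (x, t)) y
    (partial_y (partial_x E) (x, y)) /\
  is_derive (V := C_R_NormedModule) (fun s => partial_y E (s, y)) x
    (partial_y (partial_x E) (x, y)).
Proof.
intros hn hE hxy.
assert (hC := sol_Cn _ _ _ _ hE).
rewrite <- (partial_xy_comm n domD E x y hn hC hxy) at 2.
destruct n as [|n]; [lia|].
destruct (Cn2_is_derive (S n) _ _ _ _ ltac:(lia) hC hxy) as [h1 h2].
destruct hC as (_ & _ & hx & hy).
destruct (Cn2_is_derive n _ _ _ _ ltac:(lia) hx hxy) as [_ h3].
destruct (Cn2_is_derive n _ _ _ _ ltac:(lia) hy hxy) as [h4 _].
auto.
Qed.

Lemma solution_bounds (n : nat) (E0 E1 : R -> C) (E : R * R -> C) (a b : R) :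
  goursat_solution n E0 E1 E -> 0 < a -> 0 < b -> a + b < 1 ->
  exists alpha M, 0 <= alpha < 1 /\ 0 < M /\
    forall x y, 0 < x <= a -> 0 < y <= b ->
      Cmod (E (x, y)) <= M /\ / Re (E (x, y)) <= M /\
      Cmod (partial_x E (x, y)) <= M * Rpower x (- alpha) /\
      Cmod (partial_y E (x, y)) <= M * Rpower y (- alpha).
Proof.
intros hE ha hb hab.
destruct (sol_deriv _ _ _ _ hE) as (alpha & halpha & hx & hy & _).
assert (hrect : forall x y, 0 <= x <= a -> 0 <= y <= b -> domD (x, y))
  by (intros x y h1 h2; unfold domD; simpl; lra).
(* With the trivial weight 1 and [E] as its own extension, this bounds [E] itself. *)
destruct (weighted_extension_bounded domD domD (fun _ => 1) E a b) as (M1 & hM1 & B1);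
  [lra|lra|exact hrect| |].
{ exists E; split; [exact (sol_cont _ _ _ _ hE)|intros p _; ring]. }
destruct (continuous_on_rectangle_bounded domD (fun q => / Re (E q)) a b)
  as (M2 & hM2 & B2); [lra|lra| |exact hrect|].
{ intros q hq.
  apply (filterlim_comp _ _ _ E (fun z => / Re z) _ _ _ (sol_cont _ _ _ _ hE q hq)).
  apply (continuous_comp (fun z : C => Re z) Rinv); [apply continuous_fst|].
  apply continuous_Rinv, Rgt_not_eq, (sol_pos _ _ _ _ hE q hq). }
destruct (weighted_extension_bounded _ _ _ _ a b ltac:(lra) ltac:(lra) hrect hx)
  as (M3 & hM3 & B3).
destruct (weighted_extension_bounded _ _ _ _ a b ltac:(lra) ltac:(lra) hrect hy)
  as (M4 & hM4 & B4).
exists alpha, (M1 + M2 + M3 + M4); split; [exact halpha|]; split; [lra|].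
intros x y hx0 hy0.
assert (hU : int_domD (x, y)) by (apply interior_domD_iff; lra).
assert (hD := int_domD_domD _ hU).
specialize (B1 x y ltac:(lra) ltac:(lra) hD).
specialize (B2 x y ltac:(lra) ltac:(lra)).
specialize (B3 x y ltac:(lra) ltac:(lra) hU).
specialize (B4 x y ltac:(lra) ltac:(lra) hU).
simpl in B3, B4.
assert (hX : 0 < Rpower x alpha) by apply exp_pos.
assert (hY : 0 < Rpower y alpha) by apply exp_pos.
rewrite Rabs_pos_eq in B1, B3, B4 by lra.
repeat split.
- lra.
- generalize (Rle_abs (/ Re (E (x, y)))); lra.
- rewrite Rpower_Ropp. apply (Rmult_le_reg_l (Rpower x alpha)); [exact hX|].
  rewrite (Rmult_comm (M1 + M2 + M3 + M4)), <- Rmult_assoc, Rinv_r; lra.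
- rewrite Rpower_Ropp. apply (Rmult_le_reg_l (Rpower y alpha)); [exact hY|].
  rewrite (Rmult_comm (M1 + M2 + M3 + M4)), <- Rmult_assoc, Rinv_r; lra.
Qed.

Lemma solution_limit_x (n : nat) (E0 E1 : R -> C) (E : R * R -> C) (x : R) :
  goursat_solution n E0 E1 E -> 0 < x < 1 ->
  exists c : C, filterlim (partial_x E) (within int_domD (locally (x, 0))) (locally c).
Proof.
intros hE hx.
destruct (sol_deriv _ _ _ _ hE) as (alpha & _ & h & _).
apply (weighted_extension_limit _ _ _ _ (x, 0) int_domD_domD
  (fun q _ => Rgt_not_eq _ _ (exp_pos _)) h).
- unfold domD; simpl; lra.
- apply Rgt_not_eq, exp_pos.
- apply (continuous_comp fst (fun t => Rpower t alpha)); [apply continuous_fst|].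
  apply continuous_Rpower; simpl; lra.
Qed.

Lemma solution_limit_y (n : nat) (E0 E1 : R -> C) (E : R * R -> C) (y : R) :
  goursat_solution n E0 E1 E -> 0 < y < 1 ->
  exists c : C, filterlim (partial_y E) (within int_domD (locally (0, y))) (locally c).
Proof.
intros hE hy.
destruct (sol_deriv _ _ _ _ hE) as (alpha & _ & _ & h & _).
apply (weighted_extension_limit _ _ _ _ (0, y) int_domD_domD
  (fun q _ => Rgt_not_eq _ _ (exp_pos _)) h).
- unfold domD; simpl; lra.
- apply Rgt_not_eq, exp_pos.
- apply (continuous_comp snd (fun t => Rpower t alpha)); [apply continuous_snd|].
  apply continuous_Rpower; simpl; lra.
Qed.

(** * Comparison of two solutions *)

(** Both x-derivatives have limits at (x, 0), so their difference has one too; [trace_derivative]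
    forces it to be 0, since the difference of the solutions tends to 0 at the axis points to the
    left of x and at x. *)
Lemma difference_trace_x (n : nat) (E0 E1 E0' E1' : R -> C) (E E' : R * R -> C) (x : R) :
  (2 <= n)%nat -> goursat_solution n E0 E1 E -> goursat_solution n E0' E1' E' ->
  0 < x < 1 -> (forall t, 0 <= t <= x -> E (t, 0) = E' (t, 0)) ->
  vanishes_at_0 (fun y => partial_x E (x, y) - partial_x E' (x, y))%C.
Proof.
intros hn hE hE' hx heq.
destruct (solution_limit_x _ _ _ _ x hE hx) as [c hc].
destruct (solution_limit_x _ _ _ _ x hE' hx) as [c' hc'].
(* For t in (x - m, x] and 0 < y < m with this minimum m, t > 0 and t + y < 1, so (t, y) is
   interior. *)
assert (hm : 0 < Rmin x (1 - x)) by (apply Rmin_glb_lt; lra).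
assert (Rmin x (1 - x) <= x) by apply Rmin_l.
assert (Rmin x (1 - x) <= 1 - x) by apply Rmin_r.
apply (trace_derivative (fun t y => E (t, y) - E' (t, y))%C
  (fun t y => partial_x E (t, y) - partial_x E' (t, y))%C
  x (Rmin x (1 - x)) (c - c')%C); [exact hm| | |].
- intros t ht.
  apply (continuous_on_vanishes_y (fun p => E p - E' p)%C).
  + apply continuous_on_Cminus; eapply sol_cont; eassumption.
  + lra.
  + rewrite heq by lra; ring.
- intros t y ht hy.
  assert (hU : int_domD (t, y)) by (apply interior_domD_iff; lra).
  apply (is_derive_minus (V := C_R_NormedModule)).
  + apply (solution_is_derive _ _ _ _ _ _ hn hE hU).
  + apply (solution_is_derive _ _ _ _ _ _ hn hE' hU).
- intros eps heps.
  destruct (filterlim_within_eps _ _ _ _ _ (filterlim_Cminus _ _ _ _ hc hc') eps heps)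
    as (d & hd & H1).
  exists (Rmin d (Rmin x (1 - x))); split; [apply Rmin_glb_lt; lra|].
  assert (Rmin d (Rmin x (1 - x)) <= d) by apply Rmin_l.
  assert (Rmin d (Rmin x (1 - x)) <= Rmin x (1 - x)) by apply Rmin_r.
  intros t y ht hy; apply H1.
  + apply interior_domD_iff; lra.
  + apply Rabs_def1; lra.
  + apply Rabs_def1; lra.
Qed.

Lemma difference_trace_y (n : nat) (E0 E1 E0' E1' : R -> C) (E E' : R * R -> C) (y : R) :
  (2 <= n)%nat -> goursat_solution n E0 E1 E -> goursat_solution n E0' E1' E' ->
  0 < y < 1 -> (forall t, 0 <= t <= y -> E (0, t) = E' (0, t)) ->
  vanishes_at_0 (fun x => partial_y E (x, y) - partial_y E' (x, y))%C.
Proof.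
intros hn hE hE' hy heq.
destruct (solution_limit_y _ _ _ _ y hE hy) as [c hc].
destruct (solution_limit_y _ _ _ _ y hE' hy) as [c' hc'].
assert (hm : 0 < Rmin y (1 - y)) by (apply Rmin_glb_lt; lra).
assert (Rmin y (1 - y) <= y) by apply Rmin_l.
assert (Rmin y (1 - y) <= 1 - y) by apply Rmin_r.
(* The coordinates are exchanged: the first argument is now the ordinate. *)
apply (trace_derivative (fun t x => E (x, t) - E' (x, t))%C
  (fun t x => partial_y E (x, t) - partial_y E' (x, t))%C
  y (Rmin y (1 - y)) (c - c')%C); [exact hm| | |].
- intros t ht.
  apply (continuous_on_vanishes_x (fun p => E p - E' p)%C).
  + apply continuous_on_Cminus; eapply sol_cont; eassumption.
  + lra.
  + rewrite heq by lra; ring.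
- intros t x ht hx.
  assert (hU : int_domD (x, t)) by (apply interior_domD_iff; lra).
  apply (is_derive_minus (V := C_R_NormedModule)).
  + apply (solution_is_derive _ _ _ _ _ _ hn hE hU).
  + apply (solution_is_derive _ _ _ _ _ _ hn hE' hU).
- intros eps heps.
  destruct (filterlim_within_eps _ _ _ _ _ (filterlim_Cminus _ _ _ _ hc hc') eps heps)
    as (d & hd & H1).
  exists (Rmin d (Rmin y (1 - y))); split; [apply Rmin_glb_lt; lra|].
  assert (Rmin d (Rmin y (1 - y)) <= d) by apply Rmin_l.
  assert (Rmin d (Rmin y (1 - y)) <= Rmin y (1 - y)) by apply Rmin_r.
  intros t x ht hx; apply H1.
  + apply interior_domD_iff; lra.
  + apply Rabs_def1; lra.
  + apply Rabs_def1; lra.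
Qed.

Lemma ernst_mixed_partial (E : R * R -> C) (x y : R) :
  x + y < 1 -> 0 < Re (E (x, y)) -> ernst_at E x y ->
  (partial_y (partial_x E) (x, y) =
   (partial_x E (x, y) + partial_y E (x, y)) * RtoC (/ (2 * (1 - x - y)))
   + partial_x E (x, y) * partial_y E (x, y) / RtoC (Re (E (x, y))))%C.
Proof.
intros hxy hr h; unfold ernst_at in h; rewrite <- h, RtoC_inv by lra.
field; split; intros h0; apply RtoC_inj in h0; lra.
Qed.

(** The half-open rectangle of [singular_goursat_zero] contains its corner (a, b), so agreement of
    the data on [0, a] and [0, b] suffices to reach that point. *)
Lemma goursat_local_uniqueness (n : nat) (E0 E1 E0' E1' : R -> C) (E E' : R * R -> C)
    (a b : R) :
  (2 <= n)%nat -> goursat_solution n E0 E1 E -> goursat_solution n E0' E1' E' ->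
  0 < a -> 0 < b -> a + b < 1 ->
  (forall t, 0 <= t <= a -> E (t, 0) = E' (t, 0)) ->
  (forall t, 0 <= t <= b -> E (0, t) = E' (0, t)) ->
  E (a, b) = E' (a, b).
Proof.
intros hn hE hE' ha hb hab h0 h1.
destruct (solution_bounds _ _ _ _ a b hE ha hb hab) as (al & M & hal & hM & B).
destruct (solution_bounds _ _ _ _ a b hE' ha hb hab) as (al' & M' & hal' & hM' & B').
set (be := Rmax al al').
assert (hbe : be < 1) by (apply Rmax_lub_lt; lra).
assert (al <= be) by apply Rmax_l.
assert (al' <= be) by apply Rmax_r.
set (N := M + M').
set (k := / (2 * (1 - a - b))).
assert (hk : 0 < k) by (apply Rinv_0_lt_compat; lra).
assert (hN : 0 < N) by (unfold N; lra).
(* The sum [N] of the two bounds serves for each solution and, by the triangle inequality, for the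
   differences. The exponent is written [1 - be - 1] to match [gam - 1] with gam = 1 - be. *)
assert (hP : forall x y, 0 < x <= a -> 0 < y <= b ->
  Cmod (E (x, y)) <= N /\ Cmod (E' (x, y)) <= N /\
  / Re (E (x, y)) <= N /\ / Re (E' (x, y)) <= N /\
  Cmod (partial_x E (x, y)) <= N * Rpower x (1 - be - 1) /\
  Cmod (partial_x E' (x, y)) <= N * Rpower x (1 - be - 1) /\
  Cmod (partial_y E (x, y)) <= N * Rpower y (1 - be - 1) /\
  Cmod (partial_y E' (x, y)) <= N * Rpower y (1 - be - 1) /\
  Cmod (partial_x E (x, y) - partial_x E' (x, y)) <= N * Rpower x (1 - be - 1) /\
  Cmod (partial_y E (x, y) - partial_y E' (x, y)) <= N * Rpower y (1 - be - 1) /\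
  Cmod (E (x, y) - E' (x, y)) <= N).
{ intros x y hx hy; unfold N.
  destruct (B x y hx hy) as (b1 & b2 & b3 & b4).
  destruct (B' x y hx hy) as (b1' & b2' & b3' & b4').
  replace (1 - be - 1) with (- be) by ring.
  assert (x1 := Rpower_opp_le x al be ltac:(lra) ltac:(lra)).
  assert (x2 := Rpower_opp_le x al' be ltac:(lra) ltac:(lra)).
  assert (y1 := Rpower_opp_le y al be ltac:(lra) ltac:(lra)).
  assert (y2 := Rpower_opp_le y al' be ltac:(lra) ltac:(lra)).
  assert (hX : 0 < Rpower x (- be)) by apply exp_pos.
  assert (hY : 0 < Rpower y (- be)) by apply exp_pos.
  assert (tri : forall p q : C, Cmod (p - q) <= Cmod p + Cmod q).
  { intros p q; rewrite <- (Cmod_opp q); apply Cmod_triangle. }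
  assert (t1 := tri (partial_x E (x, y)) (partial_x E' (x, y))).
  assert (t2 := tri (partial_y E (x, y)) (partial_y E' (x, y))).
  assert (t3 := tri (E (x, y)) (E' (x, y))).
  apply (Rmult_le_compat_l M) in x1, y1; [|lra|lra].
  apply (Rmult_le_compat_l M') in x2, y2; [|lra|lra].
  assert (0 < M * Rpower x (- be)) by nra. assert (0 < M' * Rpower x (- be)) by nra.
  assert (0 < M * Rpower y (- be)) by nra. assert (0 < M' * Rpower y (- be)) by nra.
  repeat split; lra. }
assert (hz : (E (a, b) - E' (a, b))%C = RtoC 0).
(* In K, the summand k bounds 1 / (2 (1 - x - y)) on the rectangle, N^2 comes from 1/r times one
   first derivative, and N^4 from 1/(r r') times two of them. *)
{ apply (singular_goursat_zero (fun x y => E (x, y) - E' (x, y))%C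
    (fun x y => partial_x E (x, y) - partial_x E' (x, y))%C
    (fun x y => partial_y E (x, y) - partial_y E' (x, y))%C
    (fun x y => partial_y (partial_x E) (x, y) - partial_y (partial_x E') (x, y))%C
    a b (1 - be) (k + N * N + N * N * (N * N)) N); try lra.
  - assert (0 < N * N) by nra. nra.
  - intros y hy; apply (continuous_on_vanishes_x (fun p => E p - E' p)%C).
    + apply continuous_on_Cminus; eapply sol_cont; eassumption.
    + lra.
    + rewrite h1 by lra; ring.
  - intros x hx; apply (difference_trace_x n E0 E1 E0' E1'); auto; [lra|].
    intros t ht; apply h0; lra.
  - intros y hy; apply (difference_trace_y n E0 E1 E0' E1'); auto; [lra|].
    intros t ht; apply h1; lra.
  - intros x y hx hy.
    assert (hU : int_domD (x, y)) by (apply interior_domD_iff; lra).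
    destruct (solution_is_derive _ _ _ _ _ _ hn hE hU) as (d1 & d2 & d3 & d4).
    destruct (solution_is_derive _ _ _ _ _ _ hn hE' hU) as (d1' & d2' & d3' & d4').
    split; [|split].
    + exact (is_derive_minus (V := C_R_NormedModule) _ _ _ _ _ d1 d1').
    + exact (is_derive_minus (V := C_R_NormedModule) _ _ _ _ _ d3 d3').
    + exact (is_derive_minus (V := C_R_NormedModule) _ _ _ _ _ d4 d4').
  - intros x y hx hy; generalize (hP x y hx hy); tauto.
  - intros x y hx hy.
    assert (hU : int_domD (x, y)) by (apply interior_domD_iff; lra).
    assert (hD := int_domD_domD _ hU).
    assert (hr := sol_pos _ _ _ _ hE _ hD).
    assert (hr' := sol_pos _ _ _ _ hE' _ hD).
    rewrite (ernst_mixed_partial E x y ltac:(lra) hr (sol_eq _ _ _ _ hE _ _ hU)).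
    rewrite (ernst_mixed_partial E' x y ltac:(lra) hr' (sol_eq _ _ _ _ hE' _ _ hU)).
    assert (hk' : 0 < / (2 * (1 - x - y)) <= k).
    { split; [apply Rinv_0_lt_compat; lra|apply Rinv_le_contravar; lra]. }
    eapply Rle_trans; [apply ernst_rhs_difference; [lra|exact hr|exact hr']|].
    assert (hre : Rabs (Re (E (x, y)) - Re (E' (x, y))) <= Cmod (E (x, y) - E' (x, y)))
      by exact (re_le_Cmod (E (x, y) - E' (x, y))%C).
    destruct (hP x y hx hy) as (_ & _ & i1 & i2 & _ & p2 & q1 & q2 & _).
    (* The linear term of the equation carries no singular weight; as the weights are at least 1
       here, they can be inserted into its bound. *)
    assert (one : forall t, 0 < t <= 1 -> 1 <= Rpower t (1 - be - 1)).
    { intros t ht; replace (1 - be - 1) with (- be) by ring.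
      rewrite <- (Rpower_O t) by lra; rewrite <- Ropp_0 at 1.
      apply Rpower_opp_le; lra. }
    assert (hX := one x ltac:(lra)); assert (hY := one y ltac:(lra)).
    assert (hir := Rinv_0_lt_compat _ hr). assert (hir' := Rinv_0_lt_compat _ hr').
    assert (g1 := Cmod_ge_0 (partial_x E (x, y) - partial_x E' (x, y))).
    assert (g2 := Cmod_ge_0 (partial_y E (x, y) - partial_y E' (x, y))).
    assert (g4 := Cmod_ge_0 (partial_x E' (x, y))).
    assert (g5 := Cmod_ge_0 (partial_y E (x, y))).
    assert (g6 := Cmod_ge_0 (partial_y E' (x, y))).
    assert (g7 := Rabs_pos (Re (E (x, y)) - Re (E' (x, y)))).
    (* After abstraction a polynomial inequality in nonnegative reals remains. With S = Y p + X q,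
       the three terms of the difference are at most k S, N^2 S and N^4 X Y u. *)
    revert hk' hre i1 i2 p2 q1 q2 hX hY hir hir' g1 g2 g4 g5 g6 g7.
    generalize (/ (2 * (1 - x - y))) (Rabs (Re (E (x, y)) - Re (E' (x, y))))
      (Cmod (E (x, y) - E' (x, y))) (/ Re (E (x, y))) (/ Re (E' (x, y)))
      (Cmod (partial_x E (x, y) - partial_x E' (x, y)))
      (Cmod (partial_y E (x, y) - partial_y E' (x, y)))
      (Cmod (partial_x E' (x, y))) (Cmod (partial_y E (x, y)))
      (Cmod (partial_y E' (x, y))) (Rpower x (1 - be - 1)) (Rpower y (1 - be - 1)).
    intros k' dr u r r' p q p' q1 q' X Y; intros.
    assert (hN2 : 0 < N * N) by nra.
    assert (h1' : p + q <= Y * p + X * q) by nra.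
    assert (hXY : 0 <= X * Y) by nra.
    assert (hu : 0 <= u) by lra.
    assert (hS : 0 <= Y * p + X * q) by nra.
    assert (hXYu : 0 <= X * Y * u) by nra.
    assert (e1 : k' * (p + q) <= k * (Y * p + X * q)).
    { apply Rmult_le_compat; lra. }
    assert (e2 : r * (p * q1 + p' * q) <= N * N * (Y * p + X * q)).
    { rewrite Rmult_assoc; apply Rmult_le_compat; [lra|nra|lra|].
      assert (p * q1 <= p * (N * Y)) by (apply Rmult_le_compat_l; lra).
      assert (p' * q <= N * X * q) by (apply Rmult_le_compat_r; lra).
      lra. }
    assert (e3 : r * r' * (p' * q' * dr) <= N * N * (N * N) * (X * Y * u)).
    { replace (N * N * (N * N) * (X * Y * u)) with (N * N * ((N * X) * (N * Y) * u)) by ring.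
      assert (0 <= p' * q') by nra.
      apply Rmult_le_compat; [nra|nra| |].
      - apply Rmult_le_compat; lra.
      - apply Rmult_le_compat; [nra|lra| |lra]. apply Rmult_le_compat; lra. }
    assert (0 <= N * N * (N * N) * (Y * p + X * q)) by (apply Rmult_le_pos; nra).
    assert (0 <= (k + N * N) * (X * Y * u)) by (apply Rmult_le_pos; [lra|exact hXYu]).
    lra. }
replace (E (a, b)) with ((E (a, b) - E' (a, b)) + E' (a, b))%C by ring.
rewrite hz; ring.
Qed.

Theorem theorem2 (n : nat) (hn : (2 <= n)%nat) (alpha : R)
    (halpha : 0 <= alpha < 1) (E0 E1 : R -> C)
    (hE : admissible_data n alpha E0 E1) :
  (forall E E' : R * R -> C,
     goursat_solution n E0 E1 E -> goursat_solution n E0 E1 E' ->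
     forall p : R * R, domD p -> E p = E' p) /\
  (forall E0' E1' : R -> C, admissible_data n alpha E0' E1' ->
   forall E E' : R * R -> C,
     goursat_solution n E0 E1 E -> goursat_solution n E0' E1' E' ->
   forall x y : R, domD (x, y) ->
     (forall t, 0 <= t <= x -> E0 t = E0' t) ->
     (forall t, 0 <= t <= y -> E1 t = E1' t) ->
     E (x, y) = E' (x, y)).
Proof.
(* The local statement for two arbitrary pairs of data; uniqueness is the case of equal pairs. *)
assert (main : forall (E0 E1 E0' E1' : R -> C) (E E' : R * R -> C),
  goursat_solution n E0 E1 E -> goursat_solution n E0' E1' E' ->
  forall x y : R, domD (x, y) ->
  (forall t, 0 <= t <= x -> E0 t = E0' t) ->
  (forall t, 0 <= t <= y -> E1 t = E1' t) ->
  E (x, y) = E' (x, y)).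
{ clear E0 E1 hE; intros E0 E1 E0' E1' E E' hE hE' x y (hx & hy & hxy) h0 h1.
  simpl in hx, hy, hxy.
  assert (e0 : forall t, 0 <= t <= x -> E (t, 0) = E' (t, 0)).
  { intros t ht.
    rewrite (sol_bdry0 _ _ _ _ hE), (sol_bdry0 _ _ _ _ hE') by (unfold Ico01; lra).
    auto. }
  assert (e1 : forall t, 0 <= t <= y -> E (0, t) = E' (0, t)).
  { intros t ht.
    rewrite (sol_bdry1 _ _ _ _ hE), (sol_bdry1 _ _ _ _ hE') by (unfold Ico01; lra).
    auto. }
  (* On an axis the claim is the boundary condition itself; otherwise the point is the corner of a
     nondegenerate rectangle. *)
  destruct (Req_dec x 0) as [->|hx0]; [apply e1; lra|].
  destruct (Req_dec y 0) as [->|hy0]; [apply e0; lra|].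
  apply (goursat_local_uniqueness n E0 E1 E0' E1' E E' x y); auto; lra. }
split.
- intros E E' hS hS' [x y] hp; eapply main; eauto.
- intros E0' E1' _ E E' hS hS' x y; eapply main; eauto.
Qed.
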